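(* Let $n\ge 3$ be an integer with $\gcd(n,n-2)=1$, let $s=n-2$, and let $b$ be a positive integer. Then there exists an $s$-overlap cycle of the set of all juggling sequences of length $n$ with number of balls at most $b$.
   Context: A juggling sequence (site-swap juggling pattern) of length $n$ is a sequence $j=j_1j_2\cdots j_n$ of nonnegative integers such that the values $j_i+i \pmod n$, $i=1,\ldots,n$, are pairwise distinct and the sum $\sum_{i=1}^n j_i$ is an integer multiple of $n$. Its number of balls is the arithmetic mean $\frac1n\sum_{i=1}^n j_i$. For a finite set $W$ of sequences of length $n$ and $1\le s\le n-2$, an $s$-overlap cycle ($s$-ocycle) of $W$ is a cyclic ordering $w^{(1)},\ldots,w^{(N)}$ of all the elements of $W$, each occurring exactly once, such that for every $i$ (with $w^{(N+1)}=w^{(1)}$) the last $s$ entries of $w^{(i)}$, in order, coincide with the first $s$ entries of $w^{(i+1)}$, in order. Equivalently, it is a cyclic string of length $(n-s)N$ in which the length-$n$ windows starting at successive multiples of $n-s$ run through every element of $W$ exactly once. *)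

(* Defs.v *)
From mathcomp Require Import all_boot all_order all_algebra.

Set Implicit Arguments.
Unset Strict Implicit.
Unset Printing Implicit Defensive.

(* The entry j_{i+1} of the sequence is [tnth j i], for [i : 'I_n]; hence the
   shift by [i.+1] in the landing positions j_i + i, i = 1, ..., n. *)
Definition juggling (n : nat) (j : n.-tuple nat) : bool :=
  injectiveb (fun i : 'I_n => (tnth j i + i.+1) %% n)
  && (n %| \sum_(i < n) tnth j i).

Definition balls (n : nat) (j : n.-tuple nat) : rat :=
  ((\sum_(i < n) tnth j i)%N%:R / n%:R)%R.

Definition juggling_le (n b : nat) : pred (n.-tuple nat) :=
  [pred j | juggling j && (balls j <= b%:R)%R].
Arguments juggling_le : clear implicits.

Definition overlap (T : eqType) (n s : nat) (u v : n.-tuple T) : bool :=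
  drop (n - s) u == take s v.

(* [cycle] includes the step from the last word back to the first, which for a
   one-word list is an overlap of that word with itself. As [c] is a list with
   the same elements as [W], the set [W] is necessarily finite. *)
Definition ocycle (T : eqType) (n s : nat) (W : pred (n.-tuple T))
    (c : seq (n.-tuple T)) : Prop :=
  [/\ 1 <= s <= n - 2, uniq c, c =i W & cycle (overlap s) c].

(* Main.v *)
Require Import Defs.
From mathcomp Require Import all_boot all_order all_algebra.
From mathcomp Require Import all_fingroup.
From mathcomp Require Import zify.

Set Implicit Arguments.
Unset Strict Implicit.
Unset Printing Implicit Defensive.

Import Order.TTheory GRing.Theory Num.Theory.

(** Put n = s + 2, so n is odd, and read a juggling sequence of length n as an
    edge going from its first s entries to its last s entries, in the digraph
    whose vertices are the words of length s.  An s-overlap cycle of the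
    juggling sequences with at most b balls is an Eulerian circuit of this
    digraph.

    The digraph is balanced because rotating a juggling sequence by two places
    gives a juggling sequence with the same sum: the rotation is a bijection
    that sends every edge to an edge leaving its endpoint.  For a digraph given
    with such a bijection, [eulerian_circuit] reduces the existence of an
    Eulerian circuit to connectivity, in the form: a set of edges that contains
    one edge, and is stable under the bijection and under passing to another
    edge with the same source, contains every edge.

    For connectivity, fix such a set P containing 0...0.  As n is odd, rotations
    by two places generate all rotations, so P is stable under all rotations
    ([rot_closed]), and then under changing any two consecutive entries
    ([pair_closed]).  One such change is the site swap, which exchanges the
    landing times of two consecutive throws: it turns x+1, y into y+1, x.
    Applied at a descent, it keeps the sum and lowers the sum of squares, since
    a descent x+1, x would make two throws land together.  Hence every juggling
    sequence is carried, up to rotation, to one without cyclic descents, that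
    is, to a constant one ([linked_all]).  From the constant d+1, repeated site
    swaps carry one unit from every other entry to a single one, giving
    d+n, d, ..., d; lowering the first entry by n then gives the constant d
    ([constant_closed]), so by induction all constants are in P. *)

(** * Eulerian circuits of balanced digraphs *)

(** Hierholzer's theorem for edges [x : T] with endpoints [source x] and
    [target x]; the permutation [s0] witnesses that the digraph is balanced.
    A permutation sending each edge to one that leaves its target splits the
    edges into closed trails.  One with the fewest cycles has a single cycle:
    two cycles with edges leaving the same vertex could be joined there. *)
Lemma eulerian_circuit (T : finType) (V : eqType) (source target : T -> V)
    (s0 : {perm T}) (x0 : T) :
    (forall x, target x = source (s0 x)) ->
    (forall C : {pred T}, x0 \in C ->
       (forall x y, source x = source y -> x \in C -> y \in C) ->
       (forall x, x \in C -> s0 x \in C) -> forall x, x \in C) ->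
  exists c : seq T, [/\ uniq c, c =i T
    & path.cycle [rel x y | target x == source y] c].
Proof.
move=> s0_succ conn.
pose succ (s : {perm T}) := [forall x, target x == source (s x)].
have succ0 : succ s0 by apply/forallP => x; rewrite s0_succ.
case: (arg_minnP (fun s : {perm T} => #|porbits s|) succ0)
  => s /forallP succs mins.
have sibling x y : source x = source y -> x \in porbit s x0 -> y \in porbit s x0.
  move=> eqxy xC; apply/idPn => yC.
  (* Exchanging the predecessors of x and y joins their two cycles. *)
  pose s' := (tperm (s^-1 x) (s^-1 y) * s)%g.
  have succ' : succ s'.
    apply/forallP => z; rewrite permM; case: tpermP => [->|->|_ _] //.
      by rewrite (eqP (succs _)) !permKV eqxy.
    by rewrite (eqP (succs _)) !permKV eqxy.
  have := mins _ succ'.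
  have := porbits_mul_tperm s (s^-1 x)%g (s^-1 y)%g; rewrite /= -/s'.
  have pV z : porbit s (s^-1 z)%g = porbit s z.
    apply/eqP; rewrite eq_porbit_mem porbit_sym.
    by have := mem_porbit s 1 (s^-1 z)%g; rewrite expg1 permKV.
  have -> : (s^-1 x)%g \notin porbit s (s^-1 y)%g.
    rewrite -eq_porbit_mem !pV; apply: contra yC => /eqP eqC.
    by move: xC; rewrite -!eq_porbit_mem eqC.
  by case: (_ == _) => /=; lia.
have all_in x : x \in porbit s x0.
  apply: conn x => [|//|x xC]; first exact: porbit_id.
  (* Both s x and s0 x leave the target of x. *)
  apply: (sibling (s x)); first by rewrite -s0_succ -(eqP (succs x)).
  have := porbit_perm s 1 x; rewrite expg1 -eq_porbit_mem => ->.
  by rewrite eq_porbit_mem.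
exists (fingraph.orbit s x0); split.
- exact: orbit_uniq.
- move=> x; rewrite -fconnect_orbit !inE; have /porbitP [i ->] := all_in x.
  by rewrite permX fconnect_iter.
- apply: sub_cycle (cycle_orbit (@perm_inj _ s) x0) => x y /= /eqP <-.
  exact: succs.
Qed.

(** * Juggling sequences as plain lists *)

(** The landing times, before reduction modulo the period, of throws made at the
    beats k, k+1, ... *)
Fixpoint landings (k : nat) (u : seq nat) : seq nat :=
  if u is x :: w then (x + k) :: landings k.+1 w else [::].

(** The juggling sequences of length [n] with at most [b] balls, with the bound
    on the mean written as a bound on the sum. *)
Definition siteswap (n b : nat) (u : seq nat) : bool :=
  [&& size u == n, uniq [seq l %% n | l <- landings 1 u], n %| sumn u
    & sumn u <= b * n].

Lemma size_landings k u : size (landings k u) = size u.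
Proof. by elim: u k => //= x w IH k; rewrite IH. Qed.

Lemma nth_landings k u i :
  i < size u -> nth 0 (landings k u) i = nth 0 u i + (k + i).
Proof.
elim: u k i => //= x w IH k [|i] ltiw /=; first by rewrite addn0.
by rewrite IH // addSnnS.
Qed.

Lemma landings_cat k u v :
  landings k (u ++ v) = landings k u ++ landings (k + size u) v.
Proof.
by elim: u k => [|x w IH] k /=; rewrite ?addn0 // IH addSnnS.
Qed.

Lemma landingsS k u : landings k.+1 u = map S (landings k u).
Proof. by elim: u k => //= x w IH k; rewrite IH addnS. Qed.

(** The reason is that adding 1 permutes the residues modulo [n]. *)
Lemma uniq_modS n l :
  uniq [seq x %% n | x <- map S l] = uniq [seq x %% n | x <- l].
Proof.
have -> : [seq x %% n | x <- map S l]
    = [seq y.+1 %% n | y <- [seq x %% n | x <- l]].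
  rewrite -!map_comp; apply: eq_map => x /=.
  by rewrite -[(x %% n).+1]addn1 modnDml addn1.
rewrite map_inj_in_uniq // => _ _ /mapP [x _ ->] /mapP [y _ ->] /eqP.
by rewrite -[X in X %% _ == _]addn1 -[X in _ == X %% _]addn1 eqn_modDr !modn_mod
  => /eqP.
Qed.

(** Rotating by one place makes each throw land one beat earlier, and the throw
    moved to the end lands n - 1 beats later, which is the same modulo n. *)
Lemma siteswap_rot1 n b u : siteswap n b u -> siteswap n b (rot 1 u).
Proof.
case: u => // x w /and4P [/eqP szu uniqu dvdu leu].
have szw : (size w).+1 = n by [].
apply/and4P; split; rewrite ?size_rot ?sumn_rot ?szu //.
rewrite -uniq_modS -landingsS rot1_cons -cats1 landings_cat map_cat uniq_catC /=.
have -> : x + (2 + size w) = x + 1 + n by lia.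
by rewrite modnDr; exact: uniqu.
Qed.

Lemma siteswap_rot n b i u : siteswap n b u -> siteswap n b (rot i u).
Proof.
move=> wu; elim: i => [|i IH]; first by rewrite rot0.
have [lt_i|ge_i] := ltnP i (size u); last by rewrite rot_oversize // leqW.
by rewrite rotS // siteswap_rot1.
Qed.

(** The two throws exchange their landing times, so the landings are only
    permuted; the sum is unchanged. *)
Lemma siteswap_swap n b p q x y :
  siteswap n b (p ++ [:: x.+1, y & q]) = siteswap n b (p ++ [:: y.+1, x & q]).
Proof.
rewrite /siteswap !size_cat !sumn_cat /= !landings_cat /= !map_cat.
have -> : x.+1 + (y + sumn q) = y.+1 + (x + sumn q) by lia.
congr [&& _, _ & _]; apply: perm_uniq; rewrite perm_cat2l /= !addSnnS.
by rewrite (perm_catCA [:: _] [:: _]).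
Qed.

Lemma siteswap_sub_period n b x w :
  siteswap n b (x + n :: w) -> siteswap n b (x :: w).
Proof.
case/and4P => szu; rewrite /= addnAC modnDr => uniqu dvdu leu.
rewrite addnAC dvdn_addl // in dvdu; apply/and4P; split=> //=.
by apply: leq_trans leu; rewrite addnAC leq_addr.
Qed.

(** A throw followed by one that is smaller by 1 lands together with it. *)
Lemma siteswap_step n b p q x : ~~ siteswap n b (p ++ [:: x.+1, x & q]).
Proof.
apply/negP => /and4P [_ + _ _]; rewrite landings_cat map_cat cat_uniq /=.
by rewrite addSnnS !inE eqxx !andbF.
Qed.

Lemma siteswap0 n b : siteswap n b (nseq n 0).
Proof.
rewrite /siteswap size_nseq eqxx sumn_nseq mul0n dvdn0 /= andbT.
have -> : landings 1 (nseq n 0) = iota 1 n.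
  by elim: n 1 => //= n IH k; rewrite IH.
rewrite map_inj_in_uniq ?iota_uniq // => x y.
rewrite !mem_iota => /andP [x_gt0 lex] /andP [y_gt0 ley] /eqP eqxy.
apply/eqP; rewrite -(prednK x_gt0) -(prednK y_gt0) eqSS.
have ltx : x.-1 < n by lia.
have lty : y.-1 < n by lia.
rewrite -(modn_small ltx) -(modn_small lty) -(eqn_modDr 1) !addn1.
by rewrite !prednK.
Qed.

Lemma jugglingE n (j : n.-tuple nat) :
  juggling j = uniq [seq l %% n | l <- landings 1 j] && (n %| sumn j).
Proof.
rewrite /juggling; congr (_ && (_ %| _)).
  rewrite -[LHS]/(uniq [seq (tnth j i + i.+1) %% n | i <- enum 'I_n]); congr uniq.
  apply: (@eq_from_nth _ 0) => [|i].
    by rewrite !size_map size_landings -enumT size_enum_ord size_tuple.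
  rewrite size_map size_enum_ord => lt_i.
  rewrite (nth_map (Ordinal lt_i)) ?size_enum_ord //.
  rewrite (nth_map 0) ?size_landings ?size_tuple //.
  rewrite nth_landings ?size_tuple // (tnth_nth 0) (nth_enum_ord _ lt_i).
  by rewrite add1n.
by rewrite sumnE big_tuple.
Qed.

Lemma juggling_leE n b (j : n.-tuple nat) : 0 < n ->
  juggling_le n b j = siteswap n b j.
Proof.
move=> n_gt0; rewrite /juggling_le /siteswap /= size_tuple eqxx jugglingE -andbA.
congr [&& _, _ & _]; rewrite /balls ler_pdivrMr ?ltr0n // -natrM ler_nat.
by rewrite sumnE big_tuple.
Qed.

(** * Connectivity under rotation by two and change of the last two entries *)

(** The sets of edges closed under connectivity: [take (n - 2) u] is the source
    of the edge [u], and [rot 2 u] leaves its target. *)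
Definition linked_closed (n b : nat) (P : seq nat -> Prop) : Prop :=
  (forall u v, siteswap n b u -> siteswap n b v ->
     take (n - 2) u = take (n - 2) v -> P u -> P v)
  /\ (forall u, siteswap n b u -> P u -> P (rot 2 u)).

(** With n = 2m + 1, rotating m + 1 times by two places is rotating once. *)
Lemma rot1_closed n b P u : odd n -> 1 < n -> linked_closed n b P ->
  siteswap n b u -> P u -> P (rot 1 u).
Proof.
move=> odd_n n_gt1 [_ Prot] wu Pu.
have szu : size u = n by case/and4P: wu => /eqP.
have Peven m : m.*2 <= n -> P (rot m.*2 u).
  elim: m => [|m IH] lem; first by rewrite rot0.
  have -> : m.+1.*2 = 2 + m.*2 by rewrite doubleS.
  rewrite rotD ?szu //; apply: Prot; first exact: siteswap_rot.
  by apply: IH; rewrite doubleS in lem; lia.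
have n_half : n = (n./2.*2).+1 by rewrite -{1}(odd_double_half n) odd_n.
have rot_back : rot 1 (rot n./2.*2 u) = u.
  by rewrite -rotS ?szu -?n_half // -szu rot_size.
have := Prot _ (siteswap_rot n./2.*2 wu) (Peven _ _).
by rewrite (@rotD _ 1 1) ?size_rot ?szu // rot_back; apply; lia.
Qed.

Lemma rot_closed n b P i u : odd n -> 1 < n -> linked_closed n b P ->
  siteswap n b u -> P (rot i u) <-> P u.
Proof.
move=> odd_n n_gt1 clP.
have fwd j v : siteswap n b v -> P v -> P (rot j v).
  move=> wv Pv; elim: j => [|j IH]; first by rewrite rot0.
  have [lt_j|ge_j] := ltnP j (size v); last by rewrite rot_oversize // leqW.
  by rewrite rotS //; apply: (rot1_closed odd_n n_gt1 clP) IH; apply: siteswap_rot.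
move=> wu; split; last exact: fwd.
have [lt_i|ge_i] := leqP i (size u); last by rewrite rot_oversize // ltnW.
move/(fwd (size u - i) _ (siteswap_rot i wu)).
by rewrite -rotD subnK // rot_size.
Qed.

(** A rotation brings the changed pair to the end, where the change does not
    affect the first n - 2 entries. *)
Lemma pair_closed n b P p q x y x' y' : odd n -> 1 < n -> linked_closed n b P ->
  siteswap n b (p ++ [:: x, y & q]) -> siteswap n b (p ++ [:: x', y' & q]) ->
  P (p ++ [:: x, y & q]) <-> P (p ++ [:: x', y' & q]).
Proof.
move=> odd_n n_gt1 clP w1 w2.
have rotE a c : rot (size p + 2) (p ++ [:: a, c & q]) = (q ++ p) ++ [:: a; c].
  have -> : p ++ [:: a, c & q] = (p ++ [:: a; c]) ++ q by rewrite -catA.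
  have -> : size p + 2 = size (p ++ [:: a; c]) by rewrite size_cat.
  by rewrite rot_size_cat catA.
rewrite -(rot_closed (size p + 2) odd_n n_gt1 clP w1).
rewrite -(rot_closed (size p + 2) odd_n n_gt1 clP w2).
have /(siteswap_rot (size p + 2)) w1' := w1.
have /(siteswap_rot (size p + 2)) w2' := w2.
have szqp : size (q ++ p) = n - 2.
  by case/and4P: w1 => /eqP <- _ _ _; rewrite !size_cat /=; lia.
move: w1' w2'; rewrite !rotE => w1' w2'.
by split; apply: clP.1; rewrite // !take_size_cat.
Qed.

Lemma swap_closed n b P p q x y : odd n -> 1 < n -> linked_closed n b P ->
  siteswap n b (p ++ [:: x.+1, y & q]) ->
  P (p ++ [:: x.+1, y & q]) <-> P (p ++ [:: y.+1, x & q]).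
Proof.
move=> odd_n n_gt1 clP w; apply: (pair_closed odd_n n_gt1 clP) => //.
by rewrite -siteswap_swap.
Qed.

(** Induction on the constant.  The word [st k] has one entry that has received a
    unit from each of the [k] entries after it; a site swap leads from [st k] to
    [st k.+1].  All these words have the sum of the constant word, and
    [st n.-1] is d+n, d, ..., d. *)
Lemma constant_closed n b P d : odd n -> 1 < n -> linked_closed n b P ->
  P (nseq n 0) -> siteswap n b (nseq n d) -> P (nseq n d).
Proof.
move=> odd_n n_gt1 clP P0; elim: d => // d IH w.
pose st k := nseq (n - k.+1) d.+1 ++ (d.+1 + k) :: nseq k d.
have st0 : st 0 = nseq n d.+1.
  by rewrite /st addn0 -[[:: _]]/(nseq 1 d.+1) -nseqD subnK // ltnW.
have walk k : k < n -> siteswap n b (st k) /\ (P (st k) <-> P (st 0)).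
  elim: k => [|k IHk] ltk; first by rewrite st0.
  have [wk Pk] := IHk (ltnW ltk).
  have stE : st k = nseq (n - k.+2) d.+1 ++ [:: d.+1, d.+1 + k & nseq k d].
    by rewrite /st (_ : n - k.+1 = n - k.+2 + 1) ?nseqD -?catA //; lia.
  have stE' : st k.+1 = nseq (n - k.+2) d.+1 ++ [:: (d.+1 + k).+1, d & nseq k d].
    by rewrite /st addnS.
  rewrite stE' -siteswap_swap -stE; split=> //.
  rewrite -Pk stE; apply: iff_sym; apply: (swap_closed odd_n n_gt1 clP).
  by rewrite -stE.
have [|wlast Plast] := walk n.-1; first by rewrite ltn_predL ltnW.
rewrite -st0 -Plast.
have lastE : st n.-1 = [:: d + n, d & nseq n.-2 d].
  have [m def_n] : exists m, n = m.+2 by exists n.-2; lia.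
  by rewrite /st def_n subnn /= addSnnS.
have nseqE : nseq n d = [:: d, d & nseq n.-2 d].
  by case: (n) n_gt1 => [|[]].
rewrite lastE in wlast *; have wd := siteswap_sub_period wlast.
rewrite (@pair_closed _ _ _ [::] _ _ _ d d odd_n n_gt1 clP) //= -nseqE.
by apply: IH; rewrite nseqE.
Qed.

(** * Flattening *)

Definition energy (u : seq nat) : nat := sumn [seq x ^ 2 | x <- u].

Lemma descent_sorted (u : seq nat) : ~~ sorted leq u ->
  exists p q x y, u = p ++ [:: x, y & q] /\ y < x.
Proof.
case: u => //= x w; elim: w x => //= y w IH x.
have [lexy|ltyx] /= := leqP x y; last by exists [::], w, x, y.
by case/IH => p [q [a [c [-> ltca]]]]; exists (x :: p), q, a, c.
Qed.

Lemma sorted_rot1_constant (u : seq nat) :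
  sorted leq u -> sorted leq (rot 1 u) -> exists d, u = nseq (size u) d.
Proof.
case: u => [|x w]; first by exists 0.
rewrite rot1_cons /= path_sortedE; last exact: leq_trans.
case/andP => lexw _ sw; exists x; congr (_ :: _).
apply/all_pred1P/allP => y yw /=.
rewrite eqn_leq (allP lexw _ yw) andbT.
move: sw; rewrite -[rcons w x]revK rev_sorted rev_rcons /= path_sortedE.
  by case/andP => /allP/(_ y) + _; apply; rewrite mem_rev.
by move=> a c e leac leea; apply: leq_trans leac.
Qed.

(** A word with a descent, or with one after rotation by one place, has a site
    swap of smaller energy; the remaining words are constant. *)
Lemma linked_all n b P u : odd n -> 1 < n -> linked_closed n b P ->
  P (nseq n 0) -> siteswap n b u -> P u.
Proof.
move=> odd_n n_gt1 clP P0.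
have [m] := ubnP (energy u); elim: m u => // m IH u lt_e wu.
have flatten v : siteswap n b v -> energy v = energy u -> ~~ sorted leq v -> P v.
  move=> wv eqe /descent_sorted [p [q [[|x] [y [defv ltyx]]]]] //.
  rewrite defv in wv eqe *; apply/(swap_closed odd_n n_gt1 clP wv).
  rewrite siteswap_swap in wv.
  have neqxy : y != x.
    by apply: contraTneq wv => ->; apply: siteswap_step.
  apply: IH wv; apply: leq_trans (_ : energy u <= m); last by [].
  by rewrite -eqe /energy !map_cat !sumn_cat /=; nia.
have [su|nsu] := boolP (sorted leq u); last exact: flatten.
have [sr|nsr] := boolP (sorted leq (rot 1 u)); last first.
  apply/(rot_closed 1 odd_n n_gt1 clP wu)/flatten => //.
    exact: siteswap_rot.
  by rewrite /energy map_rot sumn_rot.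
have [d defu] := sorted_rot1_constant su sr.
have szu : size u = n by case/and4P: wu => /eqP.
rewrite defu szu in wu *; exact: constant_closed wu.
Qed.

(** * Overlap cycles of juggling sequences *)

Theorem mainTheorem4 (n s b : nat) (n_ge3 : 3 <= n)
    (co_n : gcdn n (n - 2) = 1) (s_def : s = n - 2) (b_gt0 : 0 < b) :
  exists c : seq (n.-tuple nat), ocycle s (juggling_le n b) c.
Proof.
have odd_n : odd n.
  apply: contra_eqT co_n => even_n; rewrite gtn_eqF //.
  apply: (@dvdn_leq 2); first by rewrite gcdn_gt0; lia.
  by rewrite dvdn_gcd !dvdn2 oddB ?(ltnW n_ge3) // addbF even_n.
have n_gt1 : 1 < n by apply: ltnW.
(* The entries of a sequence in question are at most its sum, hence at most
   b * n, so that finitely many candidates suffice. *)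
pose W := [seq j <- [seq map_tuple val x | x : n.-tuple 'I_(b * n).+1]
  | juggling_le n b j].
have memW j : (j \in W) = siteswap n b j.
  rewrite mem_filter juggling_leE; last exact: ltnW.
  apply: andb_idr => wj; apply/imageP.
  exists (map_tuple inord j) => //; apply: val_inj => /=.
  rewrite -map_comp -[LHS]map_id; apply/eq_in_map => x xj /=.
  rewrite inordK // ltnS; case/and4P: wj => _ _ _; apply: leq_trans.
  by rewrite (perm_sumn (perm_to_rem xj)) leq_addr.
pose T := seq_sub W.
pose r (x : T) : T := insubd x [tuple of rot 2 (val x)].
have rE x : val (r x) = rot 2 (val x) :> seq nat.
  rewrite val_insubd memW siteswap_rot // -memW; exact: valP.
have r_inj : injective r.
  by move=> x y eqr; apply/val_inj/val_inj/(@rot_inj 2); rewrite -!rE eqr.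
have zeroW : [tuple of nseq n 0] \in W.
  by rewrite memW siteswap0.
have := @eulerian_circuit T (seq nat) (fun x => take s (val x))
   (fun x => drop 2 (val x)) (perm r_inj) (SeqSub zeroW).
case=> [x|C C0 Csib Crot x|c [uniq_c memc cyc]].
- rewrite permE rE /rot take_size_cat //= size_drop size_tuple.
  by rewrite s_def.
- pose P u := exists2 z : T, val z = u :> seq nat & z \in C.
  suff: P (val x) by case=> z /val_inj/val_inj ->.
  have wT (z : T) : siteswap n b (val z) by rewrite -memW; exact: valP.
  apply: (linked_all odd_n n_gt1) (wT x); last by exists (SeqSub zeroW).
  split=> [u v _ wv + [z defu zC]|_ _ [z <- zC]]; last first.
    by exists (perm r_inj z); [rewrite permE rE | exact: Crot].
  rewrite -{u}defu => eqp; have szv : size v == n by case/and4P: wv.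
  have Wv : Tuple szv \in W by rewrite memW.
  by exists (SeqSub Wv) => //; apply: Csib zC; rewrite /= s_def.
exists (map val c); split.
- by rewrite s_def leqnn andbT; lia.
- by rewrite map_inj_uniq //; apply: val_inj.
- move=> j; rewrite -[RHS]/(juggling_le n b j) juggling_leE; last exact: ltnW.
  rewrite -memW; apply/mapP/idP => [[x _ ->]|Wj]; first exact: valP.
  by exists (SeqSub Wj); rewrite ?memc.
rewrite cycle_map; apply: sub_cycle cyc => x y /=.
by rewrite /overlap s_def subKn // ltnW.
Qed.
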